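(* Let $d\ge 1$ be an integer. For $n\ge 1$ put $HB_0^d(n):=B(nd,d)$, and for $n\ge 1$, $m_1,\dots,m_n\ge 1$ define $$\gamma: HB_0^d(n)\times HB_0^d(m_1)\times\cdots\times HB_0^d(m_n)\to HB_0^d(m_1+\cdots+m_n),$$ $$\gamma(b_0;b_1,\dots,b_n)=\Big(\cdots\big((b_0\circ_{0}b_1)\circ_{dm_1}b_2\big)\circ_{dm_1+dm_2}\cdots\Big)\circ_{dm_1+\cdots+dm_{n-1}}b_n ,$$ where $\circ_j$ is the insertion of higher Bruhat orders. Then the collection $HB_0^d=\{HB_0^d(n)\}_{n\ge1}$ with these compositions (and with the unique element of $HB_0^d(1)=B(d,d)$ as unit) is a planar operad of sets.
   Context: **Notation.** $[n]=\{1,\dots,n\}$, $[0]=\emptyset$; for an integer $a$, $a+[n]=\{a+1,\dots,a+n\}$; $\binom{[n]}{d}$ is the set of $d$-element subsets of $[n]$. **Higher Bruhat orders.** Let $1\le d\le n$. For $\mathbf i=\{i_1<\dots<i_{r}\}$ let $\hat{\mathbf i}_k=\mathbf i\setminus\{i_k\}$; the packet of $\mathbf i$ is the sequence $P(\mathbf i)=(\hat{\mathbf i}_{r},\hat{\mathbf i}_{r-1},\dots,\hat{\mathbf i}_1)$. A linear order on $\binom{[n]}{d}$ is admissible if for every $\mathbf i\in\binom{[n]}{d+1}$ its restriction to $P(\mathbf i)$ is either lexicographical ($\hat{\mathbf i}_{d+1}\prec\cdots\prec\hat{\mathbf i}_1$) or antilexicographical ($\hat{\mathbf i}_{d+1}\succ\cdots\succ\hat{\mathbf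 i}_1$). Its inversion set $Inv\subset\binom{[n]}{d+1}$ consists of those $\mathbf i$ for which the restriction to $P(\mathbf i)$ is antilexicographical. $B(n,d)$ is the set of admissible orders modulo the relation of having the same inversion set; so an element of $B(n,d)$ is determined by its inversion set. $B(d,d)$ has exactly one element. A known theorem of Ziegler says that $I\subset\binom{[n]}{d+1}$ is the inversion set of an element of $B(n,d)$ if and only if for each $\mathbf i\in\binom{[n]}{d+2}$ the set $I\cap P(\mathbf i)$ is an initial or a final segment (possibly empty or everything) of the sequence $P(\mathbf i)$. **Insertion.** Let $n,m\ge d$, $0\le j\le n-d$, $\prec\in B(n,d)$, $\prec'\in B(m,d)$. Write $[n+m-d]=A\sqcup B\sqcup C$ with $A=[j]$, $B=j+[m]$, $C=j+m+[n-(j+d)]$, and let $D=j+[d]\subset B$. Let $\phi:[n]\to A\cup D\cup C$ be the monotone bijection. Then $\prec\circ_j\prec'\in B(n+m-d,d)$ is the element whose inversion set is the set of $(d+1)$-subsets $L\subset[n+m-d]$ such that: (i) if $L\subset B$: $L-j\in Inv(\prec')$; (ii) if $L\subset A\cup D\cup C$: $\phi^{-1}(L)\in Inv(\prec)$; (iii) otherwise: $\phi^{-1}(\overline L)\in Inv(\prec)$, where $L^+=L\cap(A\cup D\cup C)$, $L^-=L\cap(B\setminus D)$, and $\overline L$ is the union of $L^+$ with the $|L^-|$ rightmost (largest) elements of $D\setminus L^+$. **Planar operad of sets.** Sets $\mathcal O(n)$, $n\ge1$, maps $\gamma:\mathcal O(k)\times\mathcal O(n_1)\times\cdots\times\mathcal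 O(n_k)\to\mathcal O(n_1+\cdots+n_k)$ and an element $I\in\mathcal O(1)$ such that $\gamma(\gamma(a;b_1,\dots,b_k);c_{1,1},\dots,c_{1,n_1},\dots,c_{k,1},\dots,c_{k,n_k})=\gamma(a;\gamma(b_1;c_{1,1},\dots,c_{1,n_1}),\dots,\gamma(b_k;c_{k,1},\dots,c_{k,n_k}))$, $\gamma(a;I,\dots,I)=a$ and $\gamma(I;a)=a$ (no symmetric group action). *)

(* Defs.v *)
From HB Require Import structures.
From mathcomp Require Import all_boot all_order.

Set Implicit Arguments.
Unset Strict Implicit.
Unset Printing Implicit Defensive.

(* The ground set [n] = {1, ..., n} is represented, with a shift by one, by
   'I_n = {0, ..., n-1}; thus the interval j + [m] becomes j <= x < j + m. *)

Section HigherBruhat.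
Variables n d : nat.
Implicit Types (A L : {set 'I_n}) (r : {set {set 'I_n} * {set 'I_n}}).

Definition dsubsets (k : nat) : {set {set 'I_n}} := [set A : {set 'I_n} | #|A| == k].

(* enum L lists L increasingly, so for L = {i_1 < ... < i_r} this is
   L \ i_r, L \ i_(r-1), ..., L \ i_1. *)
Definition packet L : seq {set 'I_n} := [seq L :\ x | x <- rev (enum L)].

Definition rel_of r : rel {set 'I_n} := fun A B => (A, B) \in r.

(* Strict linear orders on the set of d-subsets, as sets of pairs. *)
Definition linear_order r : bool :=
  [&& r \subset setX (dsubsets d) (dsubsets d),
      [forall A in dsubsets d, ~~ rel_of r A A],
      [forall A in dsubsets d, forall B in dsubsets d, forall C in dsubsets d,
         rel_of r A B && rel_of r B C ==> rel_of r A C] &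
      [forall A in dsubsets d, forall B in dsubsets d,
         (A != B) ==> rel_of r A B || rel_of r B A]].

Definition lexicographical r L : bool := sorted (rel_of r) (packet L).

Definition antilexicographical r L : bool :=
  sorted (rel_of r) (rev (packet L)).

Definition admissible r : bool :=
  linear_order r &&
  [forall L in dsubsets d.+1, lexicographical r L || antilexicographical r L].

Definition admissible_order := {r | admissible r}.

Definition inversions (o : admissible_order) : {set {set 'I_n}} :=
  [set L in dsubsets d.+1 | antilexicographical (val o) L].

Definition same_inversions : rel admissible_order :=
  fun o o' => inversions o == inversions o'.

Lemma same_inversions_refl : reflexive same_inversions.
Proof. by move=> o; apply: eqxx. Qed.

Lemma same_inversions_sym : symmetric same_inversions.
Proof. by move=> o o'; apply: eq_sym. Qed.

Lemma same_inversions_trans : transitive same_inversions.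
Proof. by move=> o1 o2 o3 /eqP e12 /eqP e23; apply/eqP; rewrite e12. Qed.

Canonical same_inversions_equiv :=
  EquivRel same_inversions same_inversions_refl
           same_inversions_sym same_inversions_trans.

End HigherBruhat.

(* B(n, d) *)
Definition bruhat (n d : nat) := {eq_quot (@same_inversions_equiv n d)}%qT.

Definition Inv (n d : nat) (b : bruhat n d) : {set {set 'I_n}} :=
  inversions (repr b).

Lemma Inv_pi (n d : nat) (o : admissible_order n d) :
  Inv (\pi_(bruhat n d) o)%qT = inversions o.
Proof.
apply/eqP; rewrite /Inv -[_ == _]/(same_inversions_equiv n d _ _).
by apply/eqmodP; rewrite reprK.
Qed.

Lemma Inv_inj (n d : nat) : injective (@Inv n d).
Proof.
move=> b b' e; rewrite -[b]reprK -[b']reprK; apply/eqmodP.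
exact/eqP.
Qed.

(* Comparison by the sum of the elements, ties being broken arbitrarily. It is
   lexicographical on every packet, and serves only as a default value. *)
Section DefaultOrder.
Variables n d : nat.
Implicit Types (A B C L : {set 'I_n}).

Let weight A := \sum_(x in A) (x : nat).

Let ltw A B :=
  (weight A < weight B) ||
  (weight A == weight B) && (enum_rank A < enum_rank B).

Definition default_rel : {set {set 'I_n} * {set 'I_n}} :=
  [set p in setX (dsubsets n d) (dsubsets n d) | ltw p.1 p.2].

Let default_relE A B : A \in dsubsets n d -> B \in dsubsets n d ->
  rel_of default_rel A B = ltw A B.
Proof. by move=> dA dB; rewrite /rel_of inE in_setX dA dB. Qed.

Lemma default_rel_admissible : admissible d default_rel.
Proof.
have ltw_trans : transitive ltw.
  move=> B A C /orP[lAB|/andP[/eqP eAB lAB]] /orP[lBC|/andP[/eqP eBC lBC]].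
  - by rewrite /ltw (ltn_trans lAB lBC).
  - by rewrite /ltw -eBC lAB.
  - by rewrite /ltw eAB lBC.
  - by rewrite /ltw eAB eBC eqxx (ltn_trans lAB lBC) orbT.
apply/andP; split.
  apply/and4P; split.
  - by apply/subsetP => p; rewrite inE => /andP[].
  - by apply/forall_inP => A dA; rewrite default_relE // /ltw !ltnn andbF.
  - apply/forall_inP => A dA; apply/forall_inP => B dB; apply/forall_inP => C dC.
    rewrite !default_relE //; apply/implyP => /andP[]; exact: ltw_trans.
  - apply/forall_inP => A dA; apply/forall_inP => B dB; apply/implyP => nAB.
    rewrite !default_relE // /ltw [weight B == _]eq_sym.
    case: (ltngtP (weight A) (weight B)) => //= _.
    case: (ltngtP (enum_rank A) (enum_rank B)) => // /val_inj/enum_rank_inj e.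
    by rewrite e eqxx in nAB.
apply/forall_inP => L; rewrite inE => /eqP cL; apply/orP; left.
rewrite /lexicographical /packet sorted_map.
have: sorted (fun x y : 'I_n => y < x) (rev (enum L)).
  rewrite rev_sorted; apply: (@subseq_sorted _ (relpre val ltn) _ _ (enum 'I_n)).
  - by move=> y x z; apply: ltn_trans.
  - by rewrite enumT; apply: filter_subseq.
  - by rewrite -sorted_map val_enum_ord iota_ltn_sorted.
apply: (sub_in_sorted (P := mem L)).
  2: by apply/allP => x; rewrite mem_rev mem_enum.
move=> x y xL yL ltyx.
have hat z : z \in L -> L :\ z \in dsubsets n d.
  by move=> zL; move/eqP: cL; rewrite inE (cardsD1 z L) zL.
rewrite /= default_relE ?hat // /ltw.
suff -> : weight (L :\ x) < weight (L :\ y) by [].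
rewrite -(ltn_add2l x) {1}/weight -big_setD1 //= (big_setD1 y) //=.
by rewrite ltn_add2r.
Qed.

Definition default_order : admissible_order n d :=
  exist _ default_rel default_rel_admissible.

End DefaultOrder.

Section Insertion.
Variables n m d j : nat.

Notation N := (n + m - d).
Implicit Types (L : {set 'I_N}).

Definition blockA : {set 'I_N} := [set x : 'I_N | x < j].
Definition blockB : {set 'I_N} := [set x : 'I_N | j <= x < j + m].
Definition blockC : {set 'I_N} := [set x : 'I_N | j + m <= x].
Definition blockD : {set 'I_N} := [set x : 'I_N | j <= x < j + d].

(* For d <= m, this is the monotone bijection from {0, ..., n-1} onto
   A u D u C. *)
Definition phi (x : nat) : nat := if x < j + d then x else x + (m - d).

(* The inverse image of L under a map f of natural numbers. *)
Definition preim_ord (f : nat -> nat) (k : nat) L : {set 'I_k} :=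
  [set x : 'I_k | [exists y in L, f x == y :> nat]].

Definition rightmost (k : nat) L : {set 'I_N} :=
  [set x in L | #|[set y in L | x < y]| < k].

Definition Lbar L : {set 'I_N} :=
  let Lplus := L :&: (blockA :|: blockD :|: blockC) in
  let Lminus := L :&: (blockB :\: blockD) in
  Lplus :|: rightmost #|Lminus| (blockD :\: Lplus).

(* No set of cardinality d+1 is contained both in B and in A u D u C. *)
Definition insertion_Inv (I : {set {set 'I_n}}) (I' : {set {set 'I_m}}) :
    {set {set 'I_N}} :=
  [set L in dsubsets N d.+1 |
    if L \subset blockB then preim_ord (addn j) m L \in I'
    else if L \subset blockA :|: blockD :|: blockC then preim_ord phi n L \in I
    else preim_ord phi n (Lbar L) \in I].

(* The element of B(n+m-d, d) with the prescribed inversion set (unique by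
   Inv_inj); the default order is returned if there is none. *)
Definition insertion (b : bruhat n d) (b' : bruhat m d) : bruhat N d :=
  (\pi_(bruhat N d) (odflt (default_order N d)
     [pick o : admissible_order N d |
        inversions o == insertion_Inv (Inv b) (Inv b')]))%qT.

End Insertion.

(* Only the arities n >= 1 belong to the operad: the values of O and gamma
   involving arity 0 are irrelevant, and the axioms do not constrain them.
   Both sides of each axiom have arities that are only provably equal, so the
   equations are stated in the total space {n & O n}. The inputs c_(i,j) are
   listed in lexicographic order of (i,j) by tagnat. *)
Record planar_operad (O : nat -> Type)
    (gamma : forall (k : nat) (n : 'I_k -> nat),
       O k -> (forall i, O (n i)) -> O (\sum_(i < k) n i))
    (I : O 1) : Prop := PlanarOperad {
  operad_assoc :
    forall (k : nat) (n : 'I_k -> nat) (l : forall i : 'I_k, 'I_(n i) -> nat)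
      (a : O k) (b : forall i, O (n i)) (c : forall i (j : 'I_(n i)), O (l i j)),
    0 < k -> (forall i, 0 < n i) -> (forall i j, 0 < l i j) ->
    Tagged O (gamma _ (fun t : 'I_(\sum_(i < k) n i) =>
                         l (tagnat.sig1 t) (tagnat.sig2 t))
                (gamma k n a b)
                (fun t => c (tagnat.sig1 t) (tagnat.sig2 t)))
    = Tagged O (gamma k (fun i => \sum_(j < n i) l i j) a
                  (fun i => gamma (n i) (l i) (b i) (c i)));
  operad_unitr :
    forall (k : nat) (a : O k), 0 < k ->
    Tagged O (gamma k (fun=> 1) a (fun=> I)) = Tagged O a;
  operad_unitl :
    forall (n : nat) (a : O n), 0 < n ->
    Tagged O (gamma 1 (fun=> n) I (fun=> a)) = Tagged O a
}.
Arguments planar_operad O gamma I : clear implicits.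

Definition HB0 (d n : nat) := bruhat (n * d) d.

Section Gamma.
Variables (d n : nat) (m : 'I_n -> nat).
Variables (b0 : HB0 d n) (b : forall i, HB0 d (m i)).

(* The arity of a partial composite is carried along as a tag. *)
Definition gamma_step (u : {N & bruhat N d}) (i : 'I_n) : {N & bruhat N d} :=
  Tagged (bruhat^~ d)
    (insertion (d * \sum_(k < n | k < i) m k) (tagged u) (b i)).

Definition gamma_iter : {N & bruhat N d} :=
  foldl gamma_step (Tagged (bruhat^~ d) b0) (enum 'I_n).

Lemma tag_gamma_iter : tag gamma_iter = (\sum_(i < n) m i) * d.
Proof.
have tag_foldl (s : seq 'I_n) u q : tag u = (q + size s) * d ->
    tag (foldl gamma_step u s) = (q + \sum_(i <- s) m i) * d.
  elim: s u q => [|i s IHs] u q /= tu; first by rewrite big_nil.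
  rewrite big_cons addnA; apply: IHs => /=.
  by rewrite tu addnS mulSn -addnA addKn -mulnDl addnAC.
rewrite /gamma_iter (tag_foldl _ _ 0) ?size_enum_ord //.
by rewrite add0n big_enum.
Qed.

Definition gamma : HB0 d (\sum_(i < n) m i) := etagged tag_gamma_iter.

End Gamma.

(* Main.v *)
Require Import Defs.
From mathcomp Require Import all_boot all_order.
From mathcomp Require Import zify.

Set Implicit Arguments.
Unset Strict Implicit.
Unset Printing Implicit Defensive.

(** In an insertion, the elements of L in B but outside D are pushed into the
    largest free positions of D. This operation (fill) is governed by one
    counting identity, cnt_fill: from any y in D on, the pushed set has as many
    elements as L has in B from y on, but at most as many as there are
    positions from y to the end of D. Both parts of the theorem follow from it.

    The inversion set of an insertion is realized by an explicit order. Write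
    bar for the pushing map, on d-subsets as well as on (d+1)-subsets. If L is not
    contained in B, then bar maps the packet of L onto the packet of bar L in
    a weakly monotone way (bar_remove): removing x from L removes min(x, c)
    from bar L in D, for a cutoff c. So d-subsets are compared first by their
    images under bar in the outer order. Two sets with image D are contained
    in B and are compared in the inner order. All the packets that have several
    sets in the fiber of some other T have the same image, the packet of
    T + max(D \ T). Whether this (d+1)-set is an inversion of the outer order
    decides whether the fiber is ordered lexicographically or in the opposite
    way. This order restricts to each packet as prescribed (less_packet).

    For the operad, the composition is computed in closed form (gammaP). If L is
    contained in the block of the i-th input, the i-th factor decides whether L
    is an inversion. Otherwise the outer element decides, applied to the result
    of pushing L in all the blocks simultaneously. The induction runs over the
    insertions (gamma_iterP), those still to come counting as blocks of size d,
    on which pushing does nothing. Associativity then compares two descriptions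
    of the same set: pushing L in the blocks of the inner composition and then
    in those of the outer one is the same as pushing once in the blocks of the
    total composition (bar_blocks_nested), because the inner step fills the
    largest free positions, which the outer step would use first anyway. *)

(** * Finite sets of natural numbers and their counting functions *)

Definition cnt (P : pred nat) (a b : nat) : nat := \sum_(a <= i < b) P i.

Lemma cnt_geq P a b : b <= a -> cnt P a b = 0.
Proof. by move=> ba; rewrite /cnt big_geq. Qed.

Lemma cnt_recl P a b : a < b -> cnt P a b = P a + cnt P a.+1 b.
Proof. by move=> ab; rewrite /cnt big_ltn. Qed.

Lemma cnt_cat P a b c : a <= b -> b <= c -> cnt P a c = cnt P a b + cnt P b c.
Proof. exact: big_cat_nat. Qed.

Lemma cnt_sub P a b c e : a <= b -> b <= c -> c <= e -> cnt P b c <= cnt P a e.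
Proof.
move=> ab bc ce; rewrite (cnt_cat _ ab (leq_trans bc ce)) (cnt_cat _ bc ce).
by rewrite addnCA leq_addr.
Qed.

Lemma cnt_le P a b : cnt P a b <= b - a.
Proof.
rewrite /cnt -[b - a]muln1 -sum_nat_const_nat.
by apply: leq_sum => i _; apply: leq_b1.
Qed.

Lemma eq_cnt P Q a b : (forall x, a <= x < b -> P x = Q x) -> cnt P a b = cnt Q a b.
Proof. by move=> e; apply: eq_big_nat => i /e ->. Qed.

Lemma cnt_shift P k a b : cnt (fun x => P (k + x)) a b = cnt P (k + a) (k + b).
Proof.
rewrite /cnt !(addnC k) [in RHS]big_addn addnK.
by apply: eq_big_nat => i _; rewrite addnC.
Qed.

Lemma cnt_gt0P (P : pred nat) a b : reflect (exists2 x, a <= x < b & P x) (0 < cnt P a b).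
Proof.
apply: (iffP idP) => [|[x xab Px]].
  have [k] := ubnP (b - a); elim: k a => // k IHk a lt_k.
  have [ba|ab] := leqP b a; first by rewrite cnt_geq.
  rewrite cnt_recl //; case Pa: (P a); first by exists a; rewrite ?leqnn.
  move/IHk; case=> [|x xab Px]; first lia.
  by exists x => //; lia.
by rewrite (@cnt_cat _ a x) ?[cnt _ x b]cnt_recl ?Px; lia.
Qed.

Lemma cnt_eq0 (P : pred nat) a b : (forall x, a <= x < b -> ~~ P x) -> cnt P a b = 0.
Proof.
move=> nP; apply/eqP; rewrite -leqn0 leqNgt; apply/cnt_gt0P => -[x xab].
by rewrite (negPf (nP x xab)).
Qed.

Lemma cnt_interval (P : pred nat) n a b : a <= b <= n ->
  cnt (fun x => P x && (a <= x < b)) 0 n = cnt P a b.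
Proof.
move=> /andP[ab bn]; rewrite (cnt_cat _ (leq0n a) (leq_trans ab bn)).
rewrite (cnt_cat _ ab bn).
rewrite [cnt _ 0 _]cnt_eq0 => [|x ?]; last by case: (P x); lia.
rewrite [cnt _ b _]cnt_eq0 => [|x ?]; last by case: (P x); lia.
by rewrite addn0; apply: eq_cnt => x ->; rewrite andbT.
Qed.

Lemma cnt_predC (P : pred nat) a b : cnt (predC P) a b = b - a - cnt P a b.
Proof.
apply/eqP; rewrite -(eqn_add2r (cnt P a b)) subnK ?cnt_le //.
rewrite /cnt -big_split /= -[b - a]muln1 -sum_nat_const_nat; apply/eqP.
by apply: eq_bigr => z _; case: (P z).
Qed.

Definition remove (P : pred nat) (x : nat) : pred nat := fun y => P y && (y != x).

Lemma cnt_remove (P : pred nat) x a b : P x -> cnt (remove P x) a b + (a <= x < b) = cnt P a b.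
Proof.
move=> Px; have out c e : (e <= x) || (x < c) -> cnt (remove P x) c e = cnt P c e.
  by move=> nx; apply: eq_cnt => y; rewrite /remove; case: eqP; lia.
have [xab|] := boolP (a <= x < b); last by move=> nx; rewrite addn0 out //; lia.
have [ax xb] : a <= x /\ x < b by lia.
rewrite !(cnt_cat _ ax (ltnW xb)) !(cnt_recl _ xb) out ?leqnn ?orbT //.
by rewrite (out x.+1 b) ?leqnn ?orbT // /remove Px eqxx /=; lia.
Qed.

(** Pushing a set into an initial part of an interval: each element of P in
    [[b, e)] is moved to one of the largest positions below b that P leaves
    free. The free position x gets filled exactly when the elements of P
    above x are too many for the b - x.+1 positions between x and b. *)
Definition fill (b e : nat) (P : pred nat) : pred nat :=
  fun x => P x || (b - x <= cnt P x.+1 e).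

(** Filling proceeds from b downwards, and stops when no element of P in
    [[b, e)] is left to be moved. The identity determines the filled set: it is
    the form in which fillings are iterated and compared. *)
Lemma cnt_fill b e P y : y <= b -> b <= e ->
  cnt (fill b e P) y b = minn (b - y) (cnt P y e).
Proof.
move=> yb be; have [k def_y] : exists k, y + k = b by exists (b - y); lia.
elim: k y yb def_y => [|k IHk] y yb def_y; first by rewrite cnt_geq; lia.
rewrite cnt_recl ?(IHk y.+1) ?[cnt _ y _]cnt_recl /fill; try lia.
Qed.

(** The positions at which P, counted up to e, does not exceed the room left
    below b form an initial segment of [[a, b]], since the excess cannot
    decrease from one position to the next. Above c there are always elements
    left to be moved, so the filled set contains everything in [[c, b)]. *)
Lemma fill_cutoff a b e P : a <= b -> cnt P a e <= b - a -> b <= e ->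
  exists2 c, a <= c <= b & forall y, a <= y <= b -> (y <= c) = (cnt P y e <= b - y).
Proof.
move=> ab Pa be; pose ok c := (a <= c <= b) && (cnt P c e <= b - c).
have ex_ok : exists c, ok c by exists a; rewrite /ok leqnn ab.
have ok_le c : ok c -> c <= b by rewrite /ok; lia.
case: (ex_maxnP ex_ok ok_le) => c /andP[abc Pc] max_c; exists c => // y aby.
apply/idP/idP => [yc|Py]; last by apply: max_c; rewrite /ok aby.
have := @cnt_cat P y c e; have := cnt_le P y c; lia.
Qed.

(** After the removal of x, there is one element less for the positions below
    x. If x lies above the cutoff c, the filling therefore stops one position
    earlier and c becomes free; if x lies below c, only x itself disappears. *)
Lemma fill_remove a b e c (P : pred nat) x y :
    a <= c <= b -> (forall z, a <= z <= b -> (z <= c) = (cnt P z e <= b - z)) ->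
    b <= e -> P x -> a <= x < e -> a <= y < b ->
  fill b e (remove P x) y = fill b e P y && (y != minn x c).
Proof.
move=> abc cutP be Px axe ayb; rewrite /fill.
have := cutP y; have := cutP y.+1; have := cnt_remove y.+1 e Px.
rewrite (@cnt_recl P y); last by lia.
case: (y =P x) => [eyx|neyx]; last first.
  by rewrite /remove (introF eqP neyx) andbT; case Py: (P y); lia.
by rewrite /remove eyx Px eqxx /=; lia.
Qed.

Lemma fill_id b P x : x < b -> fill b b P x = P x.
Proof. by move=> xb; rewrite /fill; have := cnt_le P x.+1 b; case: (P x) => /=; lia. Qed.

Lemma fill_shift k b e P x :
  fill (k + b) (k + e) P (k + x) = fill b e (fun y => P (k + y)) x.
Proof. by rewrite /fill cnt_shift subnDl addnS. Qed.

Lemma eq_fill b e P Q x : x < e -> (forall y, x <= y < e -> P y = Q y) ->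
  fill b e P x = fill b e Q x.
Proof.
move=> xe e_PQ; rewrite /fill e_PQ ?leqnn // (@eq_cnt P Q) // => y xye.
by apply: e_PQ; lia.
Qed.

(** Passing between subsets of 'I_n and predicates on natural numbers makes
    it possible to forget the ambient n, which is only known up to provable
    equality for iterated insertions. *)
Definition setof (n : nat) (P : pred nat) : {set 'I_n} := [set x : 'I_n | P x].

Definition memn (n : nat) (L : {set 'I_n}) : pred nat :=
  fun x => [exists y in L, x == y :> nat].

Lemma memnE n (L : {set 'I_n}) (x : 'I_n) : memn L x = (x \in L).
Proof.
apply/exists_inP/idP => [[y yL /eqP/val_inj ->] //|xL].
by exists x; rewrite ?eqxx.
Qed.

Lemma memn_lt n (L : {set 'I_n}) x : memn L x -> x < n.
Proof. by case/exists_inP => y _ /eqP ->. Qed.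

Lemma memn_setof n P x : memn (setof n P) x = (x < n) && P x.
Proof.
have [ltxn|] := boolP (x < n).
  by rewrite -[x]/(val (Ordinal ltxn)) memnE inE.
by apply: contraNF => /memn_lt.
Qed.

Lemma setof_memn n (L : {set 'I_n}) : setof n (memn L) = L.
Proof. by apply/setP => x; rewrite inE memnE. Qed.

Lemma eq_setof n P Q : (forall x, x < n -> P x = Q x) -> setof n P = setof n Q.
Proof. by move=> e; apply/setP => x; rewrite !inE e. Qed.

Lemma setof_inj n P Q x : setof n P = setof n Q -> x < n -> P x = Q x.
Proof. by move=> e xn; have := memn_setof n P x; rewrite e memn_setof xn. Qed.

Lemma card_setof n P : #|setof n P| = cnt P 0 n.
Proof.
rewrite -sum1_card big_mkcond /= /cnt big_mkord.
by apply: eq_bigr => i _; rewrite inE; case: (P i).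
Qed.

Lemma setof_dsubsets n k P : (setof n P \in dsubsets n k) = (cnt P 0 n == k).
Proof. by rewrite inE card_setof. Qed.

Lemma setof_remove n P (x : 'I_n) : setof n (remove P x) = setof n P :\ x.
Proof. by apply/setP => y; rewrite !inE andbC -(inj_eq val_inj). Qed.

Lemma memn_remove n (L : {set 'I_n}) (x : 'I_n) : memn (L :\ x) =1 remove (memn L) x.
Proof.
move=> y; rewrite -{1}[L]setof_memn -setof_remove memn_setof /remove.
by case Ly: (memn L y); rewrite ?andbF // (memn_lt Ly).
Qed.

(** The index set of the inserted order is [[j, j + m)], and its first d
    elements are the ones kept by phi; bar is the map sending L to the
    preimage of Lbar under phi. *)
Definition bar (d j m : nat) (P : pred nat) : pred nat := fun x =>
  if x < j then P x
  else if x < j + d then fill (j + d) (j + m) P x else P (x + (m - d)).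

Lemma cnt_bar_low d j m P a b : b <= j -> cnt (bar d j m P) a b = cnt P a b.
Proof. by move=> bj; apply: eq_cnt => x xab; rewrite /bar ifT //; lia. Qed.

Lemma cnt_bar_mid d j m P a : j <= a <= j + d -> d <= m ->
  cnt (bar d j m P) a (j + d) = minn (j + d - a) (cnt P a (j + m)).
Proof.
move=> ja dm; rewrite -cnt_fill; try lia.
by apply: eq_cnt => x xab; rewrite /bar ifF ?ifT //; lia.
Qed.

Lemma cnt_bar_high d j m P a b : j + d <= a ->
  cnt (bar d j m P) a b = cnt P (a + (m - d)) (b + (m - d)).
Proof.
move=> ja; rewrite !(addnC _ (m - d)) -cnt_shift.
by apply: eq_cnt => x xab; rewrite /bar !ifF 1?addnC //; lia.
Qed.

(** The packet of P is mapped onto the packet of bar P in a weakly monotone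
    way: by fill_remove, the element removed from bar P is g x = min(x, c) for
    x in the inserted interval. Two elements of P can have the same image only
    if it is c, and bar P contains all of [[c, j + d)]. The bound d excludes the
    sets contained in the inserted interval, for which there is no cutoff. *)
Lemma bar_remove d j m P : d <= m -> cnt P j (j + m) <= d ->
  exists g : nat -> nat, [/\ {homo g : x y / x <= y},
    forall x, P x -> bar d j m P (g x),
    forall x y, P x -> bar d j m (remove P x) y = remove (bar d j m P) (g x) y,
    forall n x, P x -> j + d <= n -> x < n + m - d -> g x < n &
    forall x y, P x -> x < y -> g x = g y ->
      [/\ j <= x, y < j + m, j <= g x < j + d &
          forall z, g x < z < j + d -> bar d j m P z]].
Proof.
move=> dm PB.
have [|||c jcd cutP] := @fill_cutoff j (j + d) (j + m) P; try lia.
pose g x := if x < j then x else if x < j + m then minn x c else x - (m - d).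
have low x : x < j -> g x = x by rewrite /g => ->.
have mid x : j <= x < j + m -> g x = minn x c.
  by move=> jxm; rewrite /g ifF ?ifT //; lia.
have high x : j + m <= x -> g x = x - (m - d).
  by move=> jmx; rewrite /g !ifF //; lia.
have gP x : x < j /\ g x = x \/ j <= x < j + m /\ g x = minn x c \/
            j + m <= x /\ g x = x - (m - d).
  by rewrite /g; case: ltnP => ?; last case: ltnP => ?; lia.
have bar_mid z : j <= z < j + d -> bar d j m P z = fill (j + d) (j + m) P z.
  by move=> jzd; rewrite /bar ifF ?ifT //; lia.
have full z : j <= z < j + d -> c <= z -> fill (j + d) (j + m) P z.
  by move=> jzd cz; rewrite /fill; have := cutP z.+1; lia.
have cP x : P x -> c <= x < j + m -> c < j + d.
  move=> Px cxm; rewrite ltn_neqAle andbC; have [_ ->] := andP jcd; apply/eqP => ec.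
  have : 0 < cnt P (j + d) (j + m) by apply/cnt_gt0P; exists x => //; lia.
  by have := cutP (j + d); lia.
exists g; split=> [x y xy|x Px|x y Px|n x Px jdn xN|x y Px xy].
- by have := gP x; have := gP y; lia.
- have [xj|jx] := ltnP x j; first by rewrite low // /bar xj.
  have [xjm|jmx] := ltnP x (j + m); last first.
    by rewrite high // /bar !ifF ?subnK //; lia.
  rewrite mid ?jx // /minn; case: (ltnP x c) => [xc|cx].
    by rewrite bar_mid /fill ?Px //; lia.
  have c_lt : c < j + d by apply: (cP x Px); lia.
  by rewrite bar_mid ?full //; lia.
- rewrite [RHS]/remove /bar.
  have [yj|jy] := ltnP y j.
    by rewrite /remove; congr (_ && _); have := gP x; lia.
  have [yjd|jdy] := ltnP y (j + d); last first.
    by rewrite /remove; congr (_ && _); have := gP x; have := cP x Px; lia.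
  have [jxm|njxm] := boolP (j <= x < j + m).
    rewrite (fill_remove jcd cutP) ?mid //; lia.
  rewrite /fill {1}/remove (_ : y != x) ?andbT; last by lia.
  rewrite (_ : y != g x) ?andbT; last by have := gP x; lia.
  have := @cnt_remove P x y.+1 (j + m) Px.
  by rewrite (_ : (y < x < j + m) = false) ?addn0 => [->|]; lia.
- by have := gP x; have := cP x Px; lia.
- move=> gxy; have [jx [yjm cx]] : j <= x /\ y < j + m /\ c <= x.
    by have := gP x; have := gP y; have := cP x Px; lia.
  have c_lt : c < j + d by apply: (cP x Px); lia.
  rewrite mid 1?jx ?(ltn_trans xy) // (minn_idPr cx); split=> //; first lia.
  by move=> z cz; rewrite bar_mid ?full; lia.
Qed.

Lemma cnt_bar_total n d j m P : d <= m -> j + d <= n -> cnt P j (j + m) <= d ->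
  cnt (bar d j m P) 0 n = cnt P 0 (n + m - d).
Proof.
move=> dm jdn PB.
rewrite (@cnt_cat _ 0 j n) 1?(@cnt_cat _ j (j + d) n); try lia.
rewrite cnt_bar_low // cnt_bar_mid ?cnt_bar_high; try lia.
rewrite [RHS](@cnt_cat _ 0 j (n + m - d)) 1?(@cnt_cat P j (j + m) (n + m - d)); try lia.
have -> : j + d + (m - d) = j + m by lia.
have -> : n + (m - d) = n + m - d by lia.
by lia.
Qed.

Lemma eq_bar d j m P Q : P =1 Q -> bar d j m P =1 bar d j m Q.
Proof.
by move=> eqPQ x; rewrite /bar /fill !eqPQ (@eq_cnt P Q) // => y _; apply: eqPQ.
Qed.

Lemma preim_ordE n m d (L : {set 'I_(n + m - d)}) f k :
  preim_ord f k L = setof k (memn L \o f).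
Proof. by []. Qed.

(** The number of free positions of D above x is j + d - x.+1 minus the number
    of elements of P there. So x is among the rightmost free positions used by
    Lbar exactly when it is filled. *)
Lemma preim_Lbar n m d j (P : pred nat) :
    d <= n -> d <= m -> j <= n - d ->
  preim_ord (phi m d j) n (Lbar j (setof (n + m - d) P)) =
    setof n (bar d j m P).
Proof.
move=> dn dm jn; rewrite preim_ordE; apply: eq_setof => x xn.
have phi_lt : phi m d j x < n + m - d by rewrite /phi; case: ifP; lia.
rewrite /= -[phi _ _ _ _]/(val (Ordinal phi_lt)) memnE.
set y := Ordinal phi_lt; rewrite /Lbar; set L := setof _ P.
set Lp := L :&: (_ :|: _); set Lm := L :&: _.
have cLm : #|Lm| = cnt P (j + d) (j + m).
  rewrite -(@cnt_interval _ (n + m - d)) -?card_setof; last by lia.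
  by congr #|pred_of_set _|; apply/setP => z; rewrite !inE; case: (P z) => //=; lia.
have LpE z : (z \in Lp) = P z && ((z < j + d) || (j + m <= z)).
  by rewrite !inE; case: (P z) => //=; lia.
have DE z : (z \in blockD n m d j :\: Lp) = ~~ P z && (j <= z < j + d).
  by rewrite in_setD LpE !inE; case: (P z) => //=; lia.
rewrite inE LpE [y \in rightmost _ _]inE DE.
rewrite /= /bar /phi.
have [xjd|jdx] := ltnP x (j + d); last first.
  have xj : (x < j) = false by lia.
  have xjd : (x + (m - d) < j + d) = false by lia.
  have jmx : j + m <= x + (m - d) by lia.
  by rewrite xj xjd jmx !andbF /= andbT orbF.
have [xj|jx] /= := ltnP x j; first by rewrite xjd andbT andbF orbF.
rewrite xjd /= !andbT /fill; case Px: (P x) => //=.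
rewrite (_ : #|_| = cnt (predC P) x.+1 (j + d)); last first.
  rewrite -(@cnt_interval _ (n + m - d)) -?card_setof; last by lia.
  congr #|pred_of_set _|; apply/setP => z; rewrite !inE.
  by case: (P z) => //=; lia.
have := cnt_le P x.+1 (j + d).
by rewrite cnt_predC cLm (@cnt_cat _ x.+1 (j + d) (j + m)); lia.
Qed.

(** Case (ii) of the definition is an instance of case (iii), since Lbar L = L
    when L has no element in B outside D. *)
Lemma mem_insertion_Inv n m d j I I' (P : pred nat) :
    d <= n -> d <= m -> j <= n - d ->
  (setof (n + m - d) P \in @insertion_Inv n m d j I I') =
    (cnt P 0 (n + m - d) == d.+1) &&
    (if cnt P j (j + m) == d.+1 then setof m (fun x => P (j + x)) \in I'
     else setof n (bar d j m P) \in I).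
Proof.
move=> dn dm jn; rewrite inE setof_dsubsets; set N := n + m - d.
case: eqP => //= cP.
have jmN : j + m <= N by rewrite /N; lia.
have cat_cnt : d.+1 = cnt P 0 j + (cnt P j (j + m) + cnt P (j + m) N).
  by rewrite -!cnt_cat //; lia.
have memP a b x : a <= x < b -> P x -> 0 < cnt P a b.
  by move=> xab Px; apply/cnt_gt0P; exists x.
have -> : (setof N P \subset blockB n m d j) = (cnt P j (j + m) == d.+1).
  apply/subsetP/eqP => [subB|cB x].
    have out x : x < N -> P x -> j <= x < j + m.
      by move=> xN Px; have := subB (Ordinal xN); rewrite !inE => /(_ Px).
    rewrite cat_cnt [cnt P 0 j]cnt_eq0 => [|x ?]; last first.
      by apply/negP => /out; lia.
    rewrite [cnt P (j + m) N]cnt_eq0 ?addn0 // => x ?.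
    by apply/negP => /out; lia.
  rewrite !inE => Px; have xN := ltn_ord x.
  have [xj|jx] := ltnP x j; first by have := memP 0 j x; lia.
  by have [//|jmx] := ltnP x (j + m); have := memP (j + m) N x; lia.
case: eqP => [_|_].
  rewrite preim_ordE (@eq_setof m _ (fun x => P (j + x))) // => x xm.
  by rewrite /= memn_setof (_ : j + x < N); lia.
rewrite preim_Lbar //; case: ifP => // /subsetP sub.
suff -> : setof n (bar d j m P) = preim_ord (phi m d j) n (setof N P) by [].
rewrite preim_ordE; apply: eq_setof => x xn /=.
rewrite memn_setof (_ : phi m d j x < N); last by rewrite /phi /N; case: ifP; lia.
have no z : j + d <= z < j + m -> ~~ P z.
  move=> zjm; apply/negP => Pz; have zN : z < N by lia.
  by have := sub (Ordinal zN); rewrite !inE /= => /(_ Pz); lia.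
rewrite /phi /bar; case: ltnP => // [xj|jx]; first by rewrite ifT //; lia.
case: ltnP => //= xjd; rewrite /fill (@cnt_cat _ x.+1 (j + d)); try lia.
rewrite [cnt _ (j + d) _]cnt_eq0 // addn0.
by have := cnt_le P x.+1 (j + d); lia.
Qed.

(** * Admissible orders *)

Definition transitive_on n d (r : {set {set 'I_n} * {set 'I_n}}) : Prop :=
  {in dsubsets n d & &, transitive (rel_of r)}.

(** A packet is indexed by the elements of L, so that for a transitive relation
    comparing consecutive sets amounts to comparing all pairs. *)
Lemma sorted_enumP n (L : {set 'I_n}) (e : rel 'I_n) :
    {in L & &, transitive e} ->
  reflect {in L &, forall x y : 'I_n, x < y -> e x y} (sorted e (enum L)).
Proof.
move=> e_tr; have lt_tr : transitive (fun x y : 'I_n => x < y).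
  by move=> y x z; apply: ltn_trans.
have lt_sorted : sorted (fun x y : 'I_n => x < y) (enum L).
  apply: (@subseq_sorted _ _ _ _ (enum 'I_n)) => //.
    by rewrite enumT; apply: filter_subseq.
  by have := iota_ltn_sorted 0 n; rewrite -val_enum_ord sorted_map.
apply: (iffP idP) => [s_e x y xL yL ltxy|lt_e].
  apply: (sorted_ltn_index_in _ s_e); rewrite ?mem_enum //.
    by move=> a b c; rewrite !mem_enum; apply: e_tr.
  rewrite ltnNge leq_eqVlt; apply/norP; split.
    apply/eqP => /(congr1 (nth x (enum L))).
    by rewrite !nth_index ?mem_enum // => eyx; rewrite eyx ltnn in ltxy.
  apply/negP => /(sorted_ltn_index lt_tr lt_sorted); rewrite !mem_enum.
  by move=> /(_ yL xL); lia.
apply: (sub_in_sorted (P := mem L)) lt_sorted => //.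
by apply/allP => x; rewrite mem_enum.
Qed.

Section Packets.
Variables (n d : nat) (r : {set {set 'I_n} * {set 'I_n}}) (L : {set 'I_n}).
Hypothesis r_tr : transitive_on d r.
Hypothesis dL : L \in dsubsets n d.+1.

Lemma dsubsets_hat x : x \in L -> L :\ x \in dsubsets n d.
Proof. by move=> xL; move: dL; rewrite !inE (cardsD1 x L) xL. Qed.

Lemma lexicographicalP :
  reflect {in L &, forall x y : 'I_n, x < y -> rel_of r (L :\ y) (L :\ x)}
          (lexicographical r L).
Proof.
rewrite /lexicographical /packet sorted_map rev_sorted.
apply: sorted_enumP => y x z yL xL zL yx zy /=.
by apply: (r_tr _ _ _ zy yx); apply: dsubsets_hat.
Qed.

Lemma antilexicographicalP :
  reflect {in L &, forall x y : 'I_n, x < y -> rel_of r (L :\ x) (L :\ y)}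
          (antilexicographical r L).
Proof.
rewrite /antilexicographical /packet -map_rev revK sorted_map.
apply: sorted_enumP => y x z yL xL zL /=.
by apply: r_tr; apply: dsubsets_hat.
Qed.

End Packets.

Section AdmissibleOrder.
Variables (n d : nat) (o : admissible_order n d).
Implicit Types A B C L : {set 'I_n}.

Lemma order_irr A : A \in dsubsets n d -> rel_of (val o) A A = false.
Proof.
case/andP: (valP o) => /and4P[_ /forall_inP irr _ _] _ /irr /negPf //.
Qed.

Lemma order_trans : transitive_on d (val o).
Proof.
case/andP: (valP o) => /and4P[_ _ tr _] _ B A C dB dA dC AB BC.
have /forall_inP/(_ _ dA)/forall_inP/(_ _ dB)/forall_inP/(_ _ dC)/implyP := tr.
by apply; rewrite AB.
Qed.

Lemma order_total A B : A \in dsubsets n d -> B \in dsubsets n d -> A != B ->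
  rel_of (val o) A B || rel_of (val o) B A.
Proof.
case/andP: (valP o) => /and4P[_ _ _ tot] _ dA dB AB.
by have /forall_inP/(_ _ dA)/forall_inP/(_ _ dB)/implyP/(_ AB) := tot.
Qed.

Lemma order_packet L x y : L \in dsubsets n d.+1 -> x \in L -> y \in L -> x < y ->
  if L \in inversions o then rel_of (val o) (L :\ x) (L :\ y)
  else rel_of (val o) (L :\ y) (L :\ x).
Proof.
move=> dL xL yL xy; rewrite [_ \in inversions o]inE dL /=.
case: ifPn => [|/negPf nanti].
  by move/(antilexicographicalP order_trans dL); apply.
case/andP: (valP o) => _ /forall_inP/(_ _ dL).
by rewrite nanti orbF => /(lexicographicalP order_trans dL); apply.
Qed.

End AdmissibleOrder.

(** * An admissible order realizing the inversion set of an insertion *)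

Section InsertionOrder.
Variables (n m d j : nat) (o : admissible_order n d) (o' : admissible_order m d).
Hypotheses (d_gt0 : 0 < d) (dn : d <= n) (dm : d <= m) (jn : j <= n - d).

Notation N := (n + m - d).
Implicit Types S L : {set 'I_N}.

Let bar_set S : {set 'I_n} := setof n (bar d j m (memn S)).
Let shift S : {set 'I_m} := setof m (fun x => memn S (j + x)).
Let D : {set 'I_n} := setof n (fun x => j <= x < j + d).

(** For a d-set T distinct from D, this is T + max(D \ T). *)
Let enlarge (T : {set 'I_n}) : {set 'I_n} :=
  T :|: [set e : 'I_n | (j <= e < j + d) &&
                        [forall z : 'I_n, (e < z < j + d) ==> (z \in T)]].

(** An injective function into nat that is increasing in the sum of the
    elements. Comparing by it is lexicographical on every packet, since removing
    a larger element leaves a smaller sum. *)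
Let key S : nat := (\sum_(x in S) x) * #|{set 'I_N}| + enum_rank S.

(** The d-subsets are compared by their images under bar_set. Those with image D
    are contained in the inserted interval, where the inserted order decides.
    For T distinct from D, let e be the largest element of D \ T, and s the
    number of elements of D above e. The fiber of T consists of a fixed set
    joined with the s-subsets of the inserted indices above e, and all the
    packets meeting it in more than one set are mapped to the packet of T + e.
    Hence the lexicographical order, or its reverse, works for all of them. *)
Let less S S' : bool :=
  if bar_set S != bar_set S' then rel_of (val o) (bar_set S) (bar_set S')
  else if bar_set S == D then rel_of (val o') (shift S) (shift S')
  else if enlarge (bar_set S) \in inversions o then key S' < key S
  else key S < key S'.

Let jdn : j + d <= n. Proof. lia. Qed.
Let jmN : j + m <= N. Proof. lia. Qed.

Lemma cnt_memn k (S : {set 'I_k}) : cnt (memn S) 0 k = #|S|.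
Proof. by rewrite -card_setof setof_memn. Qed.

Lemma key_inj : injective key.
Proof.
move=> S S' eq_key; apply/enum_rank_inj/val_inj => /=.
by rewrite -(modn_small (ltn_ord (enum_rank S))) -(modn_small (ltn_ord (enum_rank S')))
  -(modnMDl (\sum_(x in S) x)) -(modnMDl (\sum_(x in S') x) (enum_rank S')) -/(key S) eq_key.
Qed.

Lemma key_hat L x y : x \in L -> y \in L -> x < y -> key (L :\ y) < key (L :\ x).
Proof.
move=> xL yL xy; rewrite /key.
have sumL z : z \in L -> \sum_(i in L) i = z + \sum_(i in L :\ z) i :> nat.
  by move=> zL; rewrite (big_setD1 z).
have := ltn_ord (enum_rank (L :\ y)); have := sumL _ xL; rewrite (sumL _ yL).
set K := #|_|; set a := \sum_(i in _ :\ y) _; set b := \sum_(i in _ :\ x) _ => ab ltK.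
have : a.+1 * K <= b * K by apply: leq_mul => //; lia.
by rewrite mulSn; lia.
Qed.

Lemma cnt_shift_le S : S \in dsubsets N d -> cnt (memn S) j (j + m) <= d.
Proof.
rewrite inE -cnt_memn (@cnt_cat _ 0 j N) 1?(@cnt_cat _ j (j + m) N); lia.
Qed.

Lemma bar_set_dsubsets S : S \in dsubsets N d -> bar_set S \in dsubsets n d.
Proof.
move=> dS; rewrite setof_dsubsets cnt_bar_total ?cnt_shift_le //.
by rewrite cnt_memn; move: dS; rewrite inE.
Qed.

Lemma card_D : #|D| = d.
Proof.
rewrite card_setof (@cnt_interval predT n) /=; last by lia.
by rewrite -[RHS](addKn j) /cnt sum_nat_const_nat muln1.
Qed.

(** The filling of D is complete exactly when d elements are available. *)
Lemma bar_setD S : S \in dsubsets N d -> (bar_set S == D) = (cnt (memn S) j (j + m) == d).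
Proof.
move=> dS; have le_d := cnt_shift_le dS.
have : cnt (bar d j m (memn S)) j (j + d) = cnt (memn S) j (j + m).
  by rewrite cnt_bar_mid; lia.
have [eqD e|neqD e] := eqVneq (bar_set S) D.
  rewrite -e (@eq_cnt _ predT) => [|x xD]; first by rewrite /cnt sum_nat_const_nat; lia.
  by rewrite (setof_inj eqD) //; lia.
apply/esym/eqP => cS; case/eqP: neqD; apply/esym/eqP.
rewrite eqEcard card_D; have := bar_set_dsubsets dS; rewrite inE => /eqP ->.
rewrite leqnn andbT; apply/subsetP => x; rewrite !inE => xD.
apply: contraT => nbx.
have : cnt (bar d j m (memn S)) j (j + d) <= d.-1; last by lia.
rewrite (@cnt_cat _ j x) 1?(@cnt_recl _ x); try lia.
rewrite (negPf nbx).
by have := cnt_le (bar d j m (memn S)) j x;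
  have := cnt_le (bar d j m (memn S)) x.+1 (j + d); lia.
Qed.

Lemma sub_inserted S : S \in dsubsets N d -> bar_set S = D ->
  forall x, memn S x -> j <= x < j + m.
Proof.
move=> dS /eqP; rewrite bar_setD // => /eqP cS x Sx; have xN := memn_lt Sx.
move: dS; rewrite inE -cnt_memn.
rewrite (@cnt_cat _ 0 j N) 1?(@cnt_cat _ j (j + m) N) ?cS; try lia.
have memP a b : a <= x < b -> 0 < cnt (memn S) a b.
  by move=> xab; apply/cnt_gt0P; exists x.
have [xj|jx] := ltnP x j; first by have := memP 0 j; lia.
by have [//|jmx] := ltnP x (j + m); have := memP (j + m) N; lia.
Qed.

Lemma shift_dsubsets S : S \in dsubsets N d -> bar_set S = D -> shift S \in dsubsets m d.
Proof.
move=> dS /eqP; rewrite bar_setD // => cS.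
by rewrite setof_dsubsets (cnt_shift (memn S)) addn0.
Qed.

Lemma shift_inj S S' : S \in dsubsets N d -> S' \in dsubsets N d ->
  bar_set S = D -> bar_set S' = D -> shift S = shift S' -> S = S'.
Proof.
move=> dS dS' SD SD' eqS; apply/setP => x; rewrite -!memnE.
have [xB|nB] := boolP (j <= x < j + m).
  by have := setof_inj eqS (x := x - j); rewrite subnKC; [apply|]; lia.
by apply/idP/idP => [/(sub_inserted dS SD)|/(sub_inserted dS' SD')]; rewrite (negPf nB).
Qed.

Lemma less_irr S : S \in dsubsets N d -> less S S = false.
Proof.
move=> dS; rewrite /less eqxx /= !ltnn if_same; case: eqP => // SD.
by rewrite order_irr ?shift_dsubsets.
Qed.

Lemma less_trans : {in dsubsets N d & &, transitive less}.
Proof.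
move=> S' S S'' dS' dS dS''; rewrite /less.
have [bS bS' bS''] :=
  And3 (bar_set_dsubsets dS) (bar_set_dsubsets dS') (bar_set_dsubsets dS'').
have [e1|n1] /= := eqVneq (bar_set S) (bar_set S');
  have [e2|n2] /= := eqVneq (bar_set S') (bar_set S'').
- rewrite e1 e2 eqxx /=; case: eqP => [eD|_].
    by apply: order_trans; apply: shift_dsubsets; rewrite // ?e1 ?e2.
  by case: ifP => _ l1 l2; [apply: ltn_trans l2 l1 | apply: ltn_trans l1 l2].
- by rewrite e1 n2.
- by rewrite -e2 n1.
- move=> l1 l2; have l3 := order_trans bS' bS bS'' l1 l2.
  case: (bar_set S =P bar_set S'') => [e3|//]; move: l3.
  by rewrite e3 order_irr.
Qed.

Lemma less_total S S' : S \in dsubsets N d -> S' \in dsubsets N d -> S != S' ->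
  less S S' || less S' S.
Proof.
move=> dS dS' neq; rewrite /less [bar_set S' == bar_set S]eq_sym.
have [eq|neqb] /= := eqVneq (bar_set S) (bar_set S'); last first.
  by apply: order_total; rewrite ?bar_set_dsubsets.
rewrite eq; case: eqP => [eD|_].
  apply: order_total; rewrite ?shift_dsubsets ?eq //.
  by apply: contraNneq neq => /shift_inj ->; rewrite // eq.
have neqk : key S != key S' by apply: contraNneq neq => /key_inj ->.
by case: ifP => _; lia.
Qed.

(** If L lies in the inserted interval, its packet is a packet of the inner order.
    Otherwise two of its sets are mapped to two sets of the packet of bar L,
    or to the same set T; then enlarge T is bar L. *)
Lemma less_packet L x y : L \in dsubsets N d.+1 -> x \in L -> y \in L -> x < y ->
  if L \in insertion_Inv d j (inversions o) (inversions o')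
  then less (L :\ x) (L :\ y) else less (L :\ y) (L :\ x).
Proof.
move=> dL xL yL xy; have hat z := dsubsets_hat dL (x := z).
have cL : cnt (memn L) 0 N = d.+1 by move: dL; rewrite inE -cnt_memn => /eqP.
have bar_set_remove z : bar_set (L :\ z) = setof n (bar d j m (remove (memn L) z)).
  by apply: eq_setof => t tn; apply: eq_bar; apply: memn_remove.
have Lx z : z \in L -> memn L z by rewrite memnE.
have cat_cnt : cnt (memn L) 0 N =
    cnt (memn L) 0 j + (cnt (memn L) j (j + m) + cnt (memn L) (j + m) N).
  by rewrite -!cnt_cat //; lia.
rewrite -[L in L \in insertion_Inv _ _ _ _]setof_memn mem_insertion_Inv // cL eqxx /=.
have cnt_hat z : z \in L -> cnt (memn (L :\ z)) j (j + m) + (j <= z < j + m) =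
    cnt (memn L) j (j + m).
  move=> zL; rewrite (@eq_cnt _ (remove (memn L) z)) ?cnt_remove ?Lx // => s _.
  exact: memn_remove.
case: eqP => [LB|LB].
  have hatD z : z \in L -> bar_set (L :\ z) = D.
    move=> zL; apply/eqP; rewrite bar_setD ?hat //.
    have := cnt_shift_le (hat z zL); have := cnt_hat z zL; lia.
  rewrite /less !hatD // eqxx /=.
  have inB z : z \in L -> j <= z < j + m.
    by move=> zL; have := cnt_hat z zL; have := cnt_shift_le (hat z zL); lia.
  have shift_hat (z : 'I_N) (zB : z - j < m) : z \in L ->
      shift (L :\ z) = shift L :\ Ordinal zB.
    move=> zL; have := inB z zL => jzm; rewrite -setof_remove; apply: eq_setof => t tm.
    by rewrite memn_remove /remove /=; congr (_ && _); lia.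
  have xB : x - j < m by have := inB x xL; lia.
  have yB : y - j < m by have := inB y yL; lia.
  rewrite (shift_hat x xB) ?(shift_hat y yB) //.
  apply: (@order_packet m d o' (shift L)) => /=.
  - by rewrite setof_dsubsets (cnt_shift (memn L)) addn0 LB.
  - by rewrite inE /= subnKC ?Lx //; have := inB x xL; lia.
  - by rewrite inE /= subnKC ?Lx //; have := inB y yL; lia.
  - by have := inB x xL; lia.
have LBd : cnt (memn L) j (j + m) <= d by lia.
have [g [g_mono g_bar g_rem g_lt g_eq]] := bar_remove dm LBd.
have gn z : z \in L -> g z < n by move=> zL; apply: g_lt; rewrite ?Lx.
have bar_set_hat z (zL : z \in L) : bar_set (L :\ z) = bar_set L :\ Ordinal (gn z zL).
  by rewrite bar_set_remove -setof_remove; apply: eq_setof => t _; apply: g_rem; rewrite Lx.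
have bar_set_L : bar_set L \in dsubsets n d.+1.
  by rewrite setof_dsubsets cnt_bar_total // cL.
have gL z (zL : z \in L) : Ordinal (gn z zL) \in bar_set L by rewrite inE /= g_bar ?Lx.
have [gxy|] := ltnP (g x) (g y).
  have neq : bar_set (L :\ x) != bar_set (L :\ y).
    rewrite (bar_set_hat x xL) (bar_set_hat y yL); apply/eqP => /setP/(_ (Ordinal (gn x xL))).
    by rewrite !inE eqxx -(inj_eq val_inj) /= (ltn_eqF gxy) g_bar ?Lx.
  rewrite /less neq eq_sym neq (bar_set_hat x xL) (bar_set_hat y yL); exact: order_packet.
move=> gyx; have {gyx} gxy : g x = g y by apply/eqP; rewrite eqn_leq gyx g_mono // ltnW.
have [jx yjm gxD full] := g_eq x y (Lx x xL) xy gxy.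
have eq_bars : bar_set (L :\ x) = bar_set (L :\ y).
  by rewrite !bar_set_hat; congr (_ :\ _); apply: val_inj.
have notD : (bar_set (L :\ y) == D) = false.
  by rewrite bar_setD ?hat //; have := cnt_hat y yL; lia.
have -> : setof n (bar d j m (memn L)) = enlarge (bar_set (L :\ y)).
  have memT (t : 'I_n) : (t \in bar_set (L :\ y)) = bar d j m (memn L) t && (t != g y :> nat).
    by rewrite bar_set_hat in_setD1 inE andbC -(inj_eq val_inj).
  apply/setP => t; rewrite in_setU memT [in LHS]inE [in X in _ || X]inE.
  have [tg|ntg] := eqVneq (t : nat) (g y).
    rewrite andbF tg g_bar ?Lx //= -gxy gxD; apply/esym/forallP => z; apply/implyP => tz.
    by rewrite memT full ?gxy //=; lia.
  rewrite andbT; case bt: (bar d j m (memn L) t) => //=.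
  apply/esym/negP => /andP[tD /forallP/(_ (Ordinal (gn y yL)))].
  rewrite memT /= eqxx andbF; have [tg|] := ltnP t (g y); first by lia.
  by move=> gt; have := full t; rewrite bt; lia.
rewrite /less eq_bars eqxx notD /=; case: (enlarge _ \in _); exact: key_hat.
Qed.

(** The orders on the packets are prescribed by less_packet, and a packet has
    at least two sets because d > 0, so it cannot be both lexicographical and
    antilexicographical. *)
Lemma insertion_realized : exists p : admissible_order N d,
  inversions p = insertion_Inv d j (inversions o) (inversions o').
Proof.
pose r := [set p in setX (dsubsets N d) (dsubsets N d) | less p.1 p.2].
have rE S S' : S \in dsubsets N d -> S' \in dsubsets N d -> rel_of r S S' = less S S'.
  by move=> dS dS'; rewrite /rel_of inE in_setX dS dS'.
have r_tr : transitive_on d r.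
  by move=> S' S S'' dS' dS dS''; rewrite !rE //; apply: less_trans.
have anti L : L \in dsubsets N d.+1 ->
    L \in insertion_Inv d j (inversions o) (inversions o') ->
    antilexicographical r L.
  move=> dL LI; apply/(antilexicographicalP r_tr dL) => x y xL yL xy.
  by rewrite rE ?(dsubsets_hat dL) //; have := less_packet dL xL yL xy; rewrite LI.
have lex L : L \in dsubsets N d.+1 ->
    L \notin insertion_Inv d j (inversions o) (inversions o') ->
    lexicographical r L.
  move=> dL /negPf LI; apply/(lexicographicalP r_tr dL) => x y xL yL xy.
  by rewrite rE ?(dsubsets_hat dL) //; have := less_packet dL xL yL xy; rewrite LI.
have adm : admissible d r.
  apply/andP; split; last first.
    apply/forall_inP => L dL; apply/orP.
    by have [LI|LI] := boolP (L \in insertion_Inv d j (inversions o) (inversions o'));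
      [right; apply: anti | left; apply: lex].
  apply/and4P; split.
  - by apply/subsetP => p; rewrite inE => /andP[].
  - by apply/forall_inP => S dS; rewrite rE ?less_irr.
  - apply/forall_inP => S dS; apply/forall_inP => S' dS'; apply/forall_inP => S'' dS''.
    by apply/implyP => /andP[]; apply: r_tr.
  - apply/forall_inP => S dS; apply/forall_inP => S' dS'; apply/implyP => neq.
    by rewrite !rE ?less_total.
exists (exist _ r adm); apply/setP => L; rewrite inE /=.
have [dL|ndL] /= := boolP (L \in dsubsets N d.+1); last first.
  by apply/esym/negP; rewrite inE (negPf ndL).
have [LI|LI] := boolP (L \in insertion_Inv _ _ _ _); first exact: anti.
apply/negP => /(antilexicographicalP r_tr dL) antiL.
have /(lexicographicalP r_tr dL) lexL := lex L dL LI.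
have : 1 < #|L| by move: dL; rewrite inE => /eqP ->.
case/card_gt1P => x [y [xL yL]]; rewrite -val_eqE neq_ltn /= => /orP[] lt.
- have := r_tr _ _ _ (dsubsets_hat dL yL) (dsubsets_hat dL xL) (dsubsets_hat dL xL)
    (antiL x y xL yL lt) (lexL x y xL yL lt).
  by rewrite rE ?less_irr ?(dsubsets_hat dL).
- have := r_tr _ _ _ (dsubsets_hat dL yL) (dsubsets_hat dL xL) (dsubsets_hat dL xL)
    (lexL y x yL xL lt) (antiL y x yL xL lt).
  by rewrite rE ?less_irr ?(dsubsets_hat dL).
Qed.

End InsertionOrder.

Lemma Inv_insertion n m d j (b : bruhat n d) (b' : bruhat m d) :
  0 < d -> d <= n -> d <= m -> j <= n - d ->
  Inv (insertion j b b') = insertion_Inv d j (Inv b) (Inv b').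
Proof.
move=> d_gt0 dn dm jn; rewrite /insertion Inv_pi.
case: pickP => /= [p /eqP //|none].
have [p def_p] := insertion_realized (repr b) (repr b') d_gt0 dn dm jn.
by have := none p; rewrite def_p eqxx.
Qed.

(** * The composition of the operad in closed form *)

(** Inversions are tested on predicates on nat, so that elements of B(n, d) and
    B(n', d) can be compared without transport along n = n'. *)
Definition invp n d (b : bruhat n d) (P : pred nat) : bool := setof n P \in Inv b.

Lemma eq_invp n d (b : bruhat n d) P Q :
  (forall x, x < n -> P x = Q x) -> invp b P = invp b Q.
Proof. by move=> e; rewrite /invp (eq_setof e). Qed.

Lemma Inv_dsubsets n d (b : bruhat n d) L : L \in Inv b -> L \in dsubsets n d.+1.
Proof. by rewrite [_ \in Inv b]inE => /andP[]. Qed.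

Lemma bruhat_ext n d (b b' : bruhat n d) :
  (forall P, cnt P 0 n = d.+1 -> invp b P = invp b' P) -> b = b'.
Proof.
move=> e; apply/Inv_inj/setP => L.
have [dL|ndL] := boolP (L \in dsubsets n d.+1).
  by rewrite -(setof_memn L); apply: e; rewrite cnt_memn; move: dL; rewrite inE => /eqP.
by apply/idP/idP => /Inv_dsubsets dL; rewrite dL in ndL.
Qed.

Lemma Tagged_HB0_ext d n n' (b : HB0 d n) (b' : HB0 d n') : n = n' ->
    (forall P, cnt P 0 (n * d) = d.+1 -> invp b P = invp b' P) ->
  Tagged (HB0 d) b = Tagged (HB0 d) b'.
Proof.
by move=> e; case: _ / e b' => b' eq_inv; congr Tagged; apply: bruhat_ext.
Qed.

Lemma invp_insertion n m d j (b : bruhat n d) (b' : bruhat m d) P :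
    0 < d -> d <= n -> d <= m -> j <= n - d -> cnt P 0 (n + m - d) = d.+1 ->
  invp (insertion j b b') P =
    if cnt P j (j + m) == d.+1 then invp b' (fun x => P (j + x))
    else invp b (bar d j m P).
Proof.
move=> d_gt0 dn dm jn cP.
by rewrite /invp Inv_insertion // mem_insertion_Inv // cP eqxx.
Qed.

(** The simultaneous version of bar: s lists the offsets of consecutive blocks,
    and the k-th block is pushed into its first d positions, which then
    become the positions d * k, ..., d * k + d - 1. *)
Definition bar_blocks d (s : nat -> nat) (P : pred nat) : pred nat := fun x =>
  fill (s (x %/ d) + d) (s (x %/ d).+1) P (s (x %/ d) + x %% d).

Lemma bar_blocksE d s P k r : r < d ->
  bar_blocks d s P (d * k + r) = fill (s k + d) (s k.+1) P (s k + r).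
Proof.
move=> rd; rewrite /bar_blocks mulnC divnMDl; last by lia.
by rewrite divn_small // addn0 modnMDl modn_small.
Qed.

Lemma cnt_bar_blocks_end d s P k r : r <= d -> s k + d <= s k.+1 ->
  cnt (bar_blocks d s P) (d * k + r) (d * k + d) = minn (d - r) (cnt P (s k + r) (s k.+1)).
Proof.
move=> rd sk; rewrite -[d - r](subnDl (s k)) -cnt_fill ?leq_add2l //.
rewrite -cnt_shift -[RHS]cnt_shift; apply: eq_cnt => x xrd.
by rewrite bar_blocksE //; lia.
Qed.

Lemma cnt_bar_blocks d s P a b : a <= b ->
    (forall k, a <= k < b -> s k + d <= s k.+1 /\ cnt P (s k) (s k.+1) <= d) ->
  s a <= s b /\ cnt (bar_blocks d s P) (d * a) (d * b) = cnt P (s a) (s b).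
Proof.
move=> ab; have [k ->] : exists k, b = a + k by exists (b - a); lia.
elim: k => [|k IHk] sP; first by rewrite addn0 !cnt_geq.
have [|sak IH] := IHk; first by move=> i iak; apply: sP; lia.
have [|sk ck] := sP (a + k); first lia.
have cP := @cnt_bar_blocks_end d s P (a + k) 0 (leq0n d) sk; rewrite !addn0 in cP.
rewrite addnS; split; first lia.
rewrite (@cnt_cat _ (d * a) (d * (a + k)) (d * (a + k).+1)); try lia.
rewrite IH [d * _.+1]mulnS [d + _]addnC cP.
rewrite (@cnt_cat P (s a) (s (a + k)) (s (a + k).+1)); lia.
Qed.

Definition psum n (m : 'I_n -> nat) (k : nat) : nat := \sum_(i < n | i < k) m i.

Lemma psum0 n (m : 'I_n -> nat) : psum m 0 = 0.
Proof. by rewrite /psum big_pred0. Qed.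

Lemma psumS n (m : 'I_n -> nat) (i : 'I_n) : psum m i.+1 = psum m i + m i.
Proof.
rewrite /psum (bigD1 i) ?ltnSn //= addnC; congr (_ + _); apply: eq_bigl => k.
by rewrite ltnS -(inj_eq val_inj) /=; lia.
Qed.

Lemma psum_all n (m : 'I_n -> nat) : psum m n = \sum_i m i.
Proof. by apply: eq_bigl => i; rewrite ltn_ord. Qed.

(** The offsets of the blocks after the first t insertions: the blocks from
    the t-th one on still have size d. *)
Definition offset d n (m : 'I_n -> nat) (t k : nat) : nat :=
  d * (psum m (minn k t) + (k - t)).

Lemma offset_low d n (m : 'I_n -> nat) t k : k <= t -> offset d m t k = d * psum m k.
Proof. by move=> kt; rewrite /offset (minn_idPl kt) (eqP kt) addn0. Qed.

Lemma offset_high d n (m : 'I_n -> nat) t k :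
  t <= k -> offset d m t k = d * psum m t + d * (k - t).
Proof. by move=> tk; rewrite /offset (minn_idPr tk) mulnDr. Qed.

Lemma offset_step d n (m : 'I_n -> nat) t k : (forall i, 0 < m i) -> k < n ->
  offset d m t k + d <= offset d m t k.+1.
Proof.
move=> m_gt0 kn; have [kt|tk] := ltnP k t.
  rewrite !offset_low ?(ltnW kt) // -[k]/(val (Ordinal kn)) psumS mulnDr leq_add2l.
  by rewrite leq_pmulr.
by rewrite (offset_high d m tk) (offset_high d m (leqW tk)) subSn // mulnS; lia.
Qed.

Lemma offset_mono d n (m : 'I_n -> nat) t a b : (forall i, 0 < m i) ->
  a <= b -> b <= n -> offset d m t a <= offset d m t b.
Proof.
move=> m_gt0; elim: b => [|b IHb]; first by case: a.
rewrite leq_eqVlt => /predU1P[-> //|ab] bn.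
have := offset_step d t m_gt0 bn; have := IHb ab (ltnW bn); lia.
Qed.

(** One more insertion, of size M at the t-th block: s and s' are the offsets of
    the blocks before and after it. Up to t they agree, and after t they differ
    by the M - d new indices. *)
Section Step.
Variables (d n t M : nat) (s s' : nat -> nat) (P : pred nat).
Hypotheses (dM : d <= M) (tn : t < n).
Hypotheses (s_step : forall k, k < n -> s k + d <= s k.+1) (s_t : s t.+1 = s t + d).
Hypotheses (s'_low : forall k, k <= t -> s' k = s k)
           (s'_high : forall k, t < k -> s' k = s k + (M - d)).

Let Q := bar d (s t) M P.

Let s_mono a b : a <= b -> b <= n -> s a <= s b.
Proof.
elim: b => [|b IHb]; first by case: a.
rewrite leq_eqVlt => /predU1P[-> //|ab] bn.
by have := s_step bn; have := IHb ab (ltnW bn); lia.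
Qed.

Lemma step_block k : k < n -> cnt Q (s k) (s k.+1) =
  if k == t then minn d (cnt P (s' k) (s' k.+1)) else cnt P (s' k) (s' k.+1).
Proof.
move=> kn; case: (ltngtP k t) => [kt|tk|->].
- by rewrite cnt_bar_low ?s_mono ?s'_low // ltnW.
- rewrite cnt_bar_high ?s'_high ?(leqW tk) // -s_t; apply: s_mono; lia.
- rewrite s'_low // s'_high // s_t cnt_bar_mid; try lia.
  by congr (minn _ (cnt _ _ _)); lia.
Qed.

(** Before the insertion the t-th block has size d, where pushing does nothing;
    on all other blocks, bar only shifts. *)
Lemma step_bar_blocks x : x < d * n -> bar_blocks d s Q x = bar_blocks d s' P x.
Proof.
move=> xn; have d_gt0 : 0 < d by lia.
have rd := ltn_pmod x d_gt0; set r := x %% d in rd.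
have kn : x %/ d < n by rewrite ltn_divLR // mulnC.
set k := x %/ d in kn.
have -> : x = d * k + r by rewrite mulnC; apply: divn_eq.
rewrite !bar_blocksE //; have sk := s_step kn.
case: (ltngtP k t) => [kt|tk|ekt].
- have sk1 : s k.+1 <= s t by apply: s_mono => //; apply: ltnW.
  rewrite !s'_low ?(ltnW kt) //; apply: eq_fill; first by lia.
  by move=> y ?; rewrite /Q /bar ifT //; lia.
- have sk1 : s t + d <= s k by rewrite -s_t; apply: s_mono => //; apply: ltnW.
  rewrite !s'_high ?(leqW tk) // -[s k.+1](subnKC (leq_trans (leq_addr d _) sk)).
  rewrite fill_shift.
  rewrite (_ : s k + (s k.+1 - s k) + (M - d) = s k + (M - d) + (s k.+1 - s k)); last by lia.
  rewrite fill_shift; apply: eq_fill; first by lia.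
  by move=> y ?; rewrite /Q /bar !ifF; first (congr P); lia.
- rewrite ekt s_t s'_low // s'_high // s_t fill_id; last by lia.
  rewrite /Q /bar ifF ?ifT; try lia.
  by congr fill; lia.
Qed.

End Step.

(** If L lies in a block i < t, then pushing it in the t-th block only moves
    indices after the block i. If it lies in no block, neither does its image,
    because pushing in the t-th block preserves the number of elements in
    every block. A block of size d contains no L, so nothing is required for
    the blocks i >= t. *)
Lemma gamma_iterP d n (m : 'I_n -> nat) (a : HB0 d n) (b : forall i, HB0 d (m i)) t :
    0 < d -> (forall i, 0 < m i) -> t <= n ->
  let u := foldl (gamma_step b) (Tagged (bruhat^~ d) a) (take t (enum 'I_n)) in
  let s := offset d m t in
  tag u = s n /\
  forall P, cnt P 0 (s n) = d.+1 ->
    (forall i : 'I_n, i < t -> cnt P (s i) (s i.+1) = d.+1 ->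
       invp (tagged u) P = invp (b i) (fun x => P (s i + x))) /\
    ((forall k, k < n -> cnt P (s k) (s k.+1) <= d) ->
       invp (tagged u) P = invp a (bar_blocks d s P)).
Proof.
move=> d_gt0 m_gt0; elim: t => [|t IHt] tn.
  have s0 k : offset d m 0 k = d * k by rewrite offset_high // psum0 subn0 muln0.
  rewrite take0 /=; split=> [|P cP]; first by rewrite s0 mulnC.
  split=> // _; apply: eq_invp => x xn.
  rewrite [in RHS](divn_eq x d) mulnC bar_blocksE ?ltn_mod // !s0 mulnS [d + _]addnC.
  by rewrite fill_id ?ltn_add2l ?ltn_mod // mulnC -divn_eq.
have [|] := IHt; first exact: ltnW.
pose i0 := Ordinal tn.
rewrite (take_nth i0) ?size_enum_ord // foldl_rcons.
have -> : nth i0 (enum 'I_n) t = i0 by apply: val_inj; rewrite /= nth_enum_ord.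
set u := foldl _ _ _; set s := offset d m t; set s' := offset d m t.+1.
move=> tag_u u_inv /=; rewrite -/(psum m t).
pose M := m i0 * d.
have dM : d <= M by rewrite leq_pmull.
have st : d * psum m t = s t by rewrite /s offset_low.
have s_step k : k < n -> s k + d <= s k.+1 by apply: offset_step.
have s'_low k : k <= t -> s' k = s k.
  by move=> kt; rewrite /s /s' !offset_low ?leqW.
have s_t : s t.+1 = s t + d.
  by rewrite /s offset_high // offset_low // subSnn muln1.
have s'_high k : t < k -> s' k = s k + (M - d).
  move=> tk; rewrite /s /s' !offset_high ?(ltnW tk) //.
  by rewrite -[t in psum m t.+1]/(val i0) psumS mulnDr /M [m _ * d]mulnC /=; nia.
have s_mono x y : x <= y -> y <= n -> s x <= s y by apply: offset_mono.
have s'_mono x y : x <= y -> y <= n -> s' x <= s' y by apply: offset_mono.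
have sn : s t + d <= s n by rewrite -s_t s_mono.
have tag_u' : tag u + m i0 * d - d = s' n.
  by rewrite tag_u s'_high // -/M; lia.
split=> // P cP; rewrite st.
have inv_u' : invp (insertion (s t) (tagged u) (b i0)) P =
    if cnt P (s t) (s t + M) == d.+1 then invp (b i0) (fun x => P (s t + x))
    else invp (tagged u) (bar d (s t) M P).
  by apply: invp_insertion => //; rewrite ?tag_u' // tag_u; lia.
have eM : s t + M = s' t.+1 by rewrite s'_high // s_t; lia.
rewrite inv_u' eM.
have cQ : cnt P (s t) (s' t.+1) <= d -> cnt (bar d (s t) M P) 0 (s n) = d.+1.
  move=> PB; rewrite cnt_bar_total ?eM //; rewrite -cP s'_high //; congr cnt; lia.
have block := step_block P dM tn s_step s_t s'_low s'_high.
split=> [i it ci|small].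
  have [{}it|ti] := ltnP i t; last first.
    have eit : i = t :> nat by lia.
    have -> : i = i0 by apply: val_inj.
    by move: ci; rewrite eit s'_low // => ->; rewrite eqxx.
  have out : cnt P (s t) (s' t.+1) = 0.
    have : cnt P (s' i) (s' i.+1) + cnt P (s t) (s' t.+1) <= cnt P 0 (s' n).
      rewrite (@cnt_cat _ 0 (s' i) (s' n)) 1?(@cnt_cat _ (s' i) (s' i.+1) (s' n))
        1?(@cnt_cat _ (s' i.+1) (s t) (s' n)) 1?(@cnt_cat _ (s t) (s' t.+1) (s' n))
        -?(s'_low t) ?s'_mono //; try lia.
    by rewrite ci cP; lia.
  have Q_all : cnt (bar d (s t) M P) 0 (s n) = d.+1 by apply: cQ; rewrite out.
  have [uP _] := u_inv _ Q_all.
  rewrite out /= (uP i it) ?block ?ltn_ord // ?(ltn_eqF it) //.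
  have si1 : s i.+1 <= s t by apply: s_mono => //; apply: ltnW.
  have si : s i + m i * d = s i.+1.
    by rewrite /s !offset_low ?(ltnW it) // psumS mulnDr [m i * d]mulnC.
  by rewrite s'_low ?(ltnW it) //; apply: eq_invp => x xi; rewrite /bar ifT //; lia.
have PB : cnt P (s t) (s' t.+1) <= d by rewrite -s'_low // small.
have [_ uP] := u_inv _ (cQ PB); rewrite (ltn_eqF (leq_ltn_trans PB (ltnSn d))) uP.
  by apply: eq_invp => x xn; apply: (step_bar_blocks _ dM tn s_step) => //; rewrite mulnC.
by move=> k kn; rewrite block //; case: eqP => _; rewrite ?geq_minl ?small.
Qed.

Lemma eq_bar_blocks d n s s' P Q : 0 < d -> (forall k, k <= n -> s k = s' k) ->
  P =1 Q -> forall x, x < d * n -> bar_blocks d s P x = bar_blocks d s' Q x.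
Proof.
move=> d_gt0 es ePQ x xn; have kn : x %/ d < n by rewrite ltn_divLR // mulnC.
by rewrite /bar_blocks !es ?(ltnW kn) // /fill ePQ (@eq_cnt P Q).
Qed.

(** The case t = n of gamma_iterP, in which all blocks have their final sizes. *)
Lemma gammaP d n (m : 'I_n -> nat) (a : HB0 d n) (b : forall i, HB0 d (m i)) P :
    0 < d -> (forall i, 0 < m i) -> cnt P 0 (d * psum m n) = d.+1 ->
  (forall i : 'I_n, cnt P (d * psum m i) (d * psum m i.+1) = d.+1 ->
     invp (gamma a b) P = invp (b i) (fun x => P (d * psum m i + x))) /\
  ((forall k, k < n -> cnt P (d * psum m k) (d * psum m k.+1) <= d) ->
     invp (gamma a b) P = invp a (bar_blocks d (fun k => d * psum m k) P)).
Proof.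
move=> d_gt0 m_gt0 cP.
have -> : invp (gamma a b) P = invp (tagged (gamma_iter a b)) P.
  by rewrite /gamma; move: (tag_gamma_iter a b); case: (gamma_iter a b) => N u /= e;
    rewrite /etagged; case: _ / e.
have [_] := gamma_iterP a b d_gt0 m_gt0 (leqnn n).
have low k : k <= n -> offset d m n k = d * psum m k by apply: offset_low.
rewrite take_oversize ?size_enum_ord // => /(_ P); rewrite !low // => /(_ cP) [full small].
split=> [i ci|sP]; first by rewrite (full i) ?low ?ltn_ord // ltnW.
rewrite small => [|k kn]; last by rewrite !low ?sP // ltnW.
by apply: eq_invp => x xn; apply: (@eq_bar_blocks d n); rewrite // mulnC.
Qed.

Section Offsets.
Variables (k : nat) (n : 'I_k -> nat) (l : forall i : 'I_k, 'I_(n i) -> nat).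

Let l' := fun t : 'I_(\sum_(i < k) n i) => l (tagnat.sig2 t).
Let w := fun i : 'I_k => \sum_(j < n i) l j.

(** The inputs (i, j) are numbered lexicographically, so the block of the
    input (i, j) of the total composition starts at the same place whether it
    is located directly, or inside the i-th block. *)
Lemma psum_nested (i : 'I_k) q : q <= n i ->
  psum l' (psum n i + q) = psum w i + psum (@l i) q.
Proof.
have step (i0 : 'I_k) : psum l' (psum n i0) = psum w i0 -> forall q0, q0 <= n i0 ->
    psum l' (psum n i0 + q0) = psum w i0 + psum (@l i0) q0.
  move=> e; elim=> [|q0 IHq] qn; first by rewrite addn0 psum0 addn0.
  have et : psum n i0 + q0 = tagnat.Rank i0 (Ordinal qn) :> nat by rewrite tagnat.RankEsum.
  rewrite addnS et psumS -et (IHq (ltnW qn)) -[q0 in psum _ q0.+1]/(val (Ordinal qn)) psumS.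
  rewrite addnA; congr (_ + _).
  pose F (p : {i : 'I_k & 'I_(n i)}) := l (tagged p).
  by rewrite /l' -[l _]/(F (tagnat.sig _)) /tagnat.Rank tagnat.rankK.
apply: (step); have : (i : nat) <= k by apply: ltnW.
elim: (i : nat) => [|i0 IHi] ik; first by rewrite !psum0.
rewrite -[i0]/(val (Ordinal ik)) !psumS step ?IHi //; last exact: ltnW.
by rewrite /w psum_all.
Qed.

Lemma psum_nested_block i : i <= k -> psum l' (psum n i) = psum w i.
Proof.
case: i => [|i] ik; first by rewrite !psum0.
by rewrite -[i]/(val (Ordinal ik)) !psumS psum_nested // psum_all.
Qed.

End Offsets.

(** * The operad axioms *)

Lemma psum_mono n (m : 'I_n -> nat) x y : x <= y -> psum m x <= psum m y.
Proof.
move=> xy; rewrite /psum [leqRHS](bigID (fun i : 'I_n => i < x)) /=.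
rewrite -[leqLHS]addn0 leq_add // leq_eqVlt; apply/orP; left; apply/eqP.
by apply: eq_bigl => i; case: (ltnP i x) => [ix|]; rewrite ?andbT ?andbF // (leq_trans ix).
Qed.

Lemma sum_gt0 n (m : 'I_n -> nat) : 0 < n -> (forall i, 0 < m i) -> 0 < \sum_i m i.
Proof. by case: n m => // n m _ m_gt0; rewrite big_ord_recl ltn_addr. Qed.

Section Assoc.
Variables (d k : nat) (n : 'I_k -> nat) (l : forall i : 'I_k, 'I_(n i) -> nat).
Hypotheses (d_gt0 : 0 < d) (n_gt0 : forall i, 0 < n i) (l_gt0 : forall i j, 0 < @l i j).

Let l' := fun t : 'I_(\sum_(i < k) n i) => l (tagnat.sig2 t).
Let w := fun i : 'I_k => \sum_(j < n i) l j.

Let K := \sum_(i < k) n i.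

Let l'_gt0 t : 0 < l' t. Proof. exact: l_gt0. Qed.
Let w_gt0 i : 0 < w i. Proof. exact: sum_gt0. Qed.

Let sl t := d * psum l' t.

Let sl_step t : t < K -> sl t + d <= sl t.+1.
Proof.
move=> tK; rewrite /sl -[t]/(val (Ordinal tK)) psumS mulnDr leq_add2l.
by rewrite leq_pmulr.
Qed.

Let sl_mono x y : x <= y -> sl x <= sl y.
Proof. by move=> xy; rewrite leq_mul2l psum_mono ?orbT. Qed.

Let slW i : i <= k -> sl (psum n i) = d * psum w i.
Proof. by move=> ik; rewrite /sl psum_nested_block. Qed.

Let psumK : psum n k = K. Proof. exact: psum_all. Qed.

Variable P : pred nat.
Hypothesis small : forall t, t < K -> cnt P (sl t) (sl t.+1) <= d.

Let cntQ x y : x <= y -> y <= K ->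
  cnt (bar_blocks d sl P) (d * x) (d * y) = cnt P (sl x) (sl y).
Proof.
move=> xy yK; have [|//] := @cnt_bar_blocks d sl P x y xy.
by move=> t xty; split; [apply: sl_step | apply: small]; lia.
Qed.

(** In an outer block, the inner step keeps the number of elements and fills the
    largest free ones of the first d positions; the outer step continues
    from there, with the elements of the remaining inner blocks. *)
Lemma bar_blocks_nested x : x < d * k ->
  bar_blocks d (fun i => d * psum n i) (bar_blocks d sl P) x =
  bar_blocks d (fun i => d * psum w i) P x.
Proof.
move=> xk; have rd := ltn_pmod x d_gt0; set r := x %% d in rd.
have ik : x %/ d < k by rewrite ltn_divLR // mulnC.
set i := x %/ d in ik.
have -> : x = d * i + r by rewrite mulnC; apply: divn_eq.
have nS : psum n i < psum n i.+1.
  by rewrite -[i]/(val (Ordinal ik)) psumS -addn1 leq_add2l.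
have nK : psum n i.+1 <= K by rewrite -psumK psum_mono.
rewrite !bar_blocksE // /fill bar_blocksE // -!slW ?(ltnW ik) //.
have nd : d * psum n i + d = d * (psum n i).+1 by rewrite mulnS addnC.
have nd1 : d * (psum n i).+1 <= d * psum n i.+1 by rewrite leq_mul2l nS orbT.
have sl1 := sl_step (leq_trans nS nK).
have sl2 : sl (psum n i).+1 <= sl (psum n i.+1) by apply: sl_mono.
rewrite (@cnt_cat _ _ (d * (psum n i).+1)); try lia.
rewrite cntQ // -nd -addnS cnt_bar_blocks_end //.
rewrite [in RHS](@cnt_cat _ _ (sl (psum n i).+1)); try lia.
rewrite /fill addnS; case: (P _) => //=; lia.
Qed.

(** Inside the i-th outer block, pushing is the pushing for the i-th inner
    composition. *)
Lemma bar_blocks_shift (i : 'I_k) x : x < d * n i ->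
  bar_blocks d sl P (d * psum n i + x) =
  bar_blocks d (fun j => d * psum (@l i) j) (fun y => P (d * psum w i + y)) x.
Proof.
move=> xn; have rd := ltn_pmod x d_gt0; set r := x %% d in rd.
have jn : x %/ d < n i by rewrite ltn_divLR // mulnC.
set j := x %/ d in jn.
have -> : x = d * j + r by rewrite mulnC; apply: divn_eq.
rewrite addnA -mulnDr !bar_blocksE // /sl -addnS !psum_nested ?(ltnW jn) //.
by rewrite !mulnDr -!addnA fill_shift.
Qed.

End Assoc.

(** Three cases. If L lies in the block of c i j, both sides ask c i j. If it
    lies in the i-th outer block but in no smaller one, both ask b i about
    the pushed set, by bar_blocks_shift. Otherwise both ask a, by
    bar_blocks_nested. *)
Lemma gamma_assoc d k (n : 'I_k -> nat) (l : forall i : 'I_k, 'I_(n i) -> nat)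
    (a : HB0 d k) (b : forall i, HB0 d (n i)) (c : forall i (j : 'I_(n i)), HB0 d (l i j)) :
    0 < d -> (forall i, 0 < n i) -> (forall i j, 0 < l i j) ->
  Tagged (HB0 d) (gamma (gamma a b) (fun t => c (tagnat.sig1 t) (tagnat.sig2 t)))
  = Tagged (HB0 d) (gamma a (fun i => gamma (b i) (c i))).
Proof.
move=> d_gt0 n_gt0 l_gt0.
pose K := \sum_(i < k) n i.
pose l' (t : 'I_K) := l _ (tagnat.sig2 t); pose w i := \sum_(j < n i) l i j.
have l'_gt0 t : 0 < l' t by apply: l_gt0.
have w_gt0 i : 0 < w i by apply: sum_gt0.
have psumK : psum n k = K by apply: psum_all.
have total : psum l' K = psum w k by have := psum_nested_block l (leqnn k); rewrite psumK.
apply: Tagged_HB0_ext => [|P]; first by rewrite -[LHS](psum_all l') total psum_all.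
move=> cP'; have cP : cnt P 0 (d * psum l' K) = d.+1 by rewrite (psum_all l') mulnC.
have cPw : cnt P 0 (d * psum w k) = d.+1 by rewrite -total.
have [lhs_full lhs_small] := gammaP (gamma a b)
  (fun t => c (tagnat.sig1 t) (tagnat.sig2 t)) d_gt0 l'_gt0 cP.
have [rhs_full rhs_small] := gammaP a (fun i => gamma (b i) (c i)) d_gt0 w_gt0 cPw.
have nested i q : q <= n i -> psum l' (psum n i + q) = psum w i + psum (@l i) q.
  exact: psum_nested.
have le_total t : t < K -> cnt P (d * psum l' t) (d * psum l' t.+1) <= d.+1.
  by move=> tK; rewrite -cP; apply: cnt_sub; rewrite // leq_mul2l psum_mono ?orbT.
have inner (i : 'I_k) (P' := fun x => P (d * psum w i + x)) :
    cnt P (d * psum w i) (d * psum w i.+1) = d.+1 ->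
    cnt P' 0 (d * psum (@l i) (n i)) = d.+1.
  by move=> <-; rewrite cnt_shift addn0 -mulnDr psumS psum_all.
have [/existsP[t /eqP ct]|/existsPn none] :=
    boolP [exists t : 'I_K, cnt P (d * psum l' t) (d * psum l' t.+1) == d.+1].
  rewrite (lhs_full t ct).
  set i := tagnat.sig1 t; set j := tagnat.sig2 t.
  have et : t = psum n i + j :> nat by apply: tagnat.rect.
  have slt : psum l' t = psum w i + psum (@l i) j by rewrite et nested // ltnW.
  have slt1 : psum l' t.+1 = psum w i + psum (@l i) j.+1 by rewrite et -addnS nested.
  have wS : psum w i.+1 = psum w i + psum (@l i) (n i) by rewrite psumS psum_all.
  have ci : cnt P (d * psum w i) (d * psum w i.+1) = d.+1.
    apply/eqP; rewrite eqn_leq; apply/andP; split.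
      by rewrite -cPw; apply: cnt_sub; rewrite // leq_mul2l psum_mono ?orbT.
    rewrite -ct slt slt1 wS.
    by apply: cnt_sub; rewrite leq_mul2l ?leq_add2l ?leq_addr ?psum_mono ?orbT // ltnW.
  rewrite (rhs_full i ci).
  have [inner_full _] := gammaP (b i) (c i) d_gt0 (l_gt0 i) (inner i ci).
  rewrite (inner_full j); first by apply: eq_invp => x _; rewrite slt mulnDr addnA.
  by rewrite cnt_shift -!mulnDr -slt -slt1.
have small t : t < K -> cnt P (d * psum l' t) (d * psum l' t.+1) <= d.
  move=> tK; have := none (Ordinal tK); have := le_total t tK.
  by rewrite leq_eqVlt => /orP[->|].
rewrite lhs_small //; set Q := bar_blocks d _ P.
have cntQ x y : x <= y -> y <= K ->
    cnt Q (d * x) (d * y) = cnt P (d * psum l' x) (d * psum l' y).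
  move=> xy yK; have [|//] := @cnt_bar_blocks d (fun t => d * psum l' t) P x y xy.
  move=> t xty; have tK : t < K by lia.
  split; last exact: small.
  by rewrite -[t]/(val (Ordinal tK)) psumS mulnDr leq_add2l leq_pmulr.
have cQ : cnt Q 0 (d * psum n k) = d.+1.
  by have := cntQ 0 (psum n k); rewrite psum0 muln0 psumK cP => ->.
have [mid_full mid_small] := gammaP a b d_gt0 n_gt0 cQ.
have cQi i : i < k -> cnt Q (d * psum n i) (d * psum n i.+1) =
    cnt P (d * psum w i) (d * psum w i.+1).
  move=> ik; rewrite cntQ ?psum_mono //; last by rewrite -psumK psum_mono.
  by rewrite !psum_nested_block // ltnW.
have [/existsP[i /eqP ci]|/existsPn nonew] :=
    boolP [exists i : 'I_k, cnt P (d * psum w i) (d * psum w i.+1) == d.+1].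
  rewrite (mid_full i) ?cQi // (rhs_full i ci).
  have [_ ->] := gammaP (b i) (c i) d_gt0 (l_gt0 i) (inner i ci).
    by apply: eq_invp => x xn; apply: bar_blocks_shift; rewrite // mulnC.
  move=> j jn; rewrite cnt_shift -!mulnDr -!nested //; last exact: ltnW.
  rewrite addnS; apply: small; rewrite -psumK.
  apply: leq_trans (_ : psum n i.+1 <= _); last by rewrite psum_mono.
  by rewrite psumS ltn_add2l.
have smallw i : i < k -> cnt P (d * psum w i) (d * psum w i.+1) <= d.
  move=> ik; have := nonew (Ordinal ik).
  have : cnt P (d * psum w i) (d * psum w i.+1) <= d.+1.
    by rewrite -cPw; apply: cnt_sub; rewrite // leq_mul2l psum_mono ?orbT.
  by rewrite leq_eqVlt => /orP[->|].
rewrite mid_small => [|i ik]; last by rewrite cQi ?smallw.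
rewrite rhs_small //; apply: eq_invp => x xk.
by apply: bar_blocks_nested; rewrite // mulnC.
Qed.

(** There is no (d+1)-subset of a set with d elements. *)
Lemma HB0_1_unique d (I I' : HB0 d 1) : I = I'.
Proof. by apply: bruhat_ext => P cP; have := cnt_le P 0 (1 * d); lia. Qed.

(** All blocks have size d: none contains L, and pushing is the identity. *)
Lemma gamma_unitr d k (a : HB0 d k) (I : HB0 d 1) : 0 < d ->
  Tagged (HB0 d) (gamma a (fun=> I)) = Tagged (HB0 d) a.
Proof.
move=> d_gt0; have total : \sum_(i < k) 1 = k by rewrite sum1_card card_ord.
apply: Tagged_HB0_ext => // P cP'.
have cP : cnt P 0 (d * psum (fun _ : 'I_k => 1) k) = d.+1 by rewrite psum_all mulnC.
have [_ ->] := gammaP a (fun=> I) d_gt0 (fun=> isT) cP; last first.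
  move=> i ik; rewrite -[i]/(val (Ordinal ik)) psumS.
  by apply: leq_trans (cnt_le _ _ _) _; rewrite -mulnBr addKn muln1.
have psum1 i : i <= k -> psum (fun _ : 'I_k => 1) i = i.
  elim: i => [|i IHi] ik; first by rewrite psum0.
  by rewrite (psumS _ (Ordinal ik)) IHi ?addn1 // ltnW.
apply: eq_invp => x xk; have xdk : x %/ d < k by rewrite ltn_divLR.
rewrite /bar_blocks !psum1 ?(ltnW xdk) // mulnS [d + _]addnC.
by rewrite fill_id ?ltn_add2l ?ltn_mod // mulnC -divn_eq.
Qed.

(** The only block contains everything. *)
Lemma gamma_unitl d n (a : HB0 d n) (I : HB0 d 1) : 0 < d -> 0 < n ->
  Tagged (HB0 d) (gamma I (fun=> a)) = Tagged (HB0 d) a.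
Proof.
move=> d_gt0 n_gt0; apply: Tagged_HB0_ext => [|P]; first by rewrite big_ord1.
move=> cP'.
have cP : cnt P 0 (d * psum (fun _ : 'I_1 => n) 1) = d.+1 by rewrite psum_all mulnC.
have [full _] := gammaP I (fun=> a) d_gt0 (fun=> n_gt0) cP.
by rewrite (full ord0) psum0 muln0.
Qed.

Theorem theorem6p1 (d : nat) (d_gt0 : 0 < d) :
  (forall (n m j : nat) (b : bruhat n d) (b' : bruhat m d),
     d <= n -> d <= m -> j <= n - d ->
     Inv (insertion j b b') = insertion_Inv d j (Inv b) (Inv b')) /\
  (exists I : HB0 d 1,
     (forall I' : HB0 d 1, I' = I) /\
     planar_operad (HB0 d) (@gamma d) I).
Proof.
split=> [n m j b b' dn dm jn|]; first exact: Inv_insertion.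
pose I : HB0 d 1 := (\pi_(bruhat (1 * d) d) (default_order _ d))%qT.
exists I; split=> [I'|]; first exact: HB0_1_unique.
split=> [k n l a b c _ n_gt0 l_gt0|k a _|n a n_gt0].
- exact: gamma_assoc.
- exact: gamma_unitr.
- exact: gamma_unitl.
Qed.
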